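(* Assume the map $\theta$ is invertible. Let $y \in (y_{\min}, y_{\max})$ and $\delta > 0$, let $B_\delta$ be the set attached to $y$ and $\delta$ in the context, and put $\psi_t(y) := \int_X g\circ\varphi_t \, dP_{\theta^{-1}(y)}$ for $t\in T$. Let $t_1,\dots,t_m\in T$ be a finite set of times and let $B_1,\dots,B_m\subseteq Y$ be Borel sets. Then $$\lim_{n\to\infty} \mu^n\Big[\bigcap_{i=1}^m\{G_{t_i} \in B_i\} \,\Big|\, \{G \in B_\delta\}\Big] = \begin{cases} 0, & \text{if } \psi_{t_j}(y) \notin \overline{B_j}\text{ for some } j,\\ 1, & \text{if } \psi_{t_i}(y) \in B_i^\circ \text{ for all } i,\end{cases}$$ where $\overline{B_i}$ and $B_i^\circ$ are the closure and interior of $B_i$ (in $Y$).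
   Context: Setting. $(X,d)$ is a complete separable metric space with its Borel $\sigma$-algebra, $\mu$ is a Borel probability measure on $X$, and $\mu^n$ is the $n$-fold product measure on $X^n$. $g: X\to\mathbb{R}$ is measurable, bounded, and continuous $\mu$-almost everywhere (i.e. its set of discontinuity points is $\mu$-null). $y_{\min}=\inf g(X)$, $y_{\max}=\sup g(X)$, $Y=[y_{\min},y_{\max}]$, $y_*=\int_X g\,d\mu$. $T\subseteq\mathbb{R}$ is a set of times with $0\in T$; for each $t\in T$, $\varphi_t:X\to X$ is measurable and continuous $\mu$-a.e., with $\varphi_0=\mathrm{id}$, and $g\circ\varphi_t$ is continuous $\mu$-a.e. For $(x_1,\dots,x_n)\in X^n$: $G(x_1,\dots,x_n)=\frac1n\sum_{i=1}^n g(x_i)$ and $G_t(x_1,\dots,x_n)=\frac1n\sum_{i=1}^n g(\varphi_t(x_i))$ (dependence on $n$ suppressed). Canonical measures. For $\lambda\in\mathbb{R}$, $Z(\lambda)=\int_X e^{\lambda g}\,d\mu$ and $P_\lambda$ is the probability measure with $dP_\lambda = \frac{e^{\lambda g}}{Z(\lambda)}\,d\mu$. The map $\theta:[-\infty,+\infty]\to Y$ is given by $\theta(\lambda)=\int_X g\,dP_\lambda$ for $\lambda\in\mathbb{R}$, $\theta(-\infty)=y_{\min}$, $\theta(+\infty)=y_{\max}$. Conditioning sets. For $y\in(y_{\min},y_{\max})$ and $\delta>0$: $B_\delta=(y-\delta,y]$ if $y<y_*$; $B_\delta=[y,y+\delta)$ if $y>y_*$; $B_\delta=(y_*-\delta,y_*+\delta)$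 if $y=y_*$. Conditional probabilities given $\{G\in B_\delta\}$ are considered for $n$ large enough that the conditioning event has positive probability. *)

(* Defs.v *)
From HB Require Import structures.
From mathcomp Require Import all_boot all_order all_algebra.
From mathcomp Require Import all_classical all_reals all_analysis.
From mathcomp Require Import measurable_realfun.

Set Implicit Arguments.
Unset Strict Implicit.
Unset Printing Implicit Defensive.

Import Order.TTheory GRing.Theory Num.Theory.
Import numFieldNormedType.Exports.

Local Open Scope classical_set_scope.
Local Open Scope ring_scope.

#[short(type="completeMetricType")]
HB.structure Definition CompleteMetric (R : numDomainType) :=
  { X of Metric R X & Complete X }.

Definition separable (X : topologicalType) :=
  exists2 D : set X, countable D & dense D.

(* A copy of X: it carries the Borel sigma-algebra but no topology. *)
Notation borel X := (g_sigma_algebraType (@open X)).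

Section power_probability.
Context d (T : measurableType d) (R : realType) (mu : probability T R).

Definition tuple_cons n (p : T * n.-tuple T) : n.+1.-tuple T :=
  [tuple of p.1 :: p.2].

Let measurable_tuple_cons n : measurable_fun setT (@tuple_cons n).
Proof. exact: measurable_cons measurable_fst measurable_snd. Qed.

HB.instance Definition _ n :=
  isMeasurableFun.Build _ _ _ _ (@tuple_cons n) (@measurable_tuple_cons n).

(* The n-fold product mu^n, on the product sigma-algebra of n.-tuple T. *)
Fixpoint power_probability n : probability (n.-tuple T) R :=
  if n is k.+1 then
    distribution (mu \x power_probability k)%E (@tuple_cons k)
  else dirac [tuple].

Let measurable_box n (A : 'I_n -> set T) : (forall i, measurable (A i)) ->
  measurable [set x : n.-tuple T | forall i, A i (tnth x i)].
Proof.
move=> mA; rewrite (_ : [set _ | _] =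
  \bigcap_(i in [set: 'I_n]) ((fun x : n.-tuple T => tnth x i) @^-1` A i)).
  apply: fin_bigcap_measurable => // i _; rewrite -[X in measurable X]setTI.
  exact: measurable_tnth.
by apply/seteqP; split => x /= Ax i *; exact: Ax.
Qed.

Lemma power_probabilityE n (A : 'I_n -> set T) :
  (forall i, measurable (A i)) ->
  power_probability n [set x | forall i, A i (tnth x i)] =
  (\prod_(i < n) mu (A i))%E.
Proof.
elim: n A => [|n IHn] A mA.
  rewrite big_ord0 (_ : [set _ | _] = setT) ?probability_setT//.
  by apply/seteqP; split => // x _ [].
rewrite big_ord_recl -IHn//= /distribution/= /pushforward/=.
rewrite -product_measure1E; [|exact: mA|exact: (measurable_box (fun=> mA _))].
congr (_ _); apply/seteqP; split => [[x s] /= Axs|[x s] /= [Ax As] i].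
  split; first exact: (Axs ord0).
  by move=> i; have := Axs (lift ord0 i); rewrite /tuple_cons tnthS.
by have [j ->|->] := unliftP ord0 i; rewrite /tuple_cons ?tnthS.
Qed.

End power_probability.

Section canonical_measure.
Context d (T : measurableType d) (R : realType).
Variables (mu : probability T R) (g : {mfun T >-> R}).

Definition partition_function (lambda : R) : R :=
  \int[mu]_x expR (lambda * g x).

Definition canonical_measure (lambda : R) (A : set T) : \bar R :=
  (\int[mu]_(x in A) (expR (lambda * g x) / partition_function lambda)%:E)%E.

Section canonical_measure_is_measure.
Variable lambda : R.

Let density_ge0 x : 0 <= expR (lambda * g x) / partition_function lambda.
Proof.
by rewrite divr_ge0 ?expR_ge0// Rintegral_ge0// => ? _; exact: expR_ge0.
Qed.

Let canonical_measure0 : canonical_measure lambda set0 = 0%E.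
Proof. exact: integral_set0. Qed.

Let canonical_measure_ge0 A : (0 <= canonical_measure lambda A)%E.
Proof. by apply: integral_ge0 => x _; rewrite lee_fin density_ge0. Qed.

Let canonical_measure_sigma_additive :
  semi_sigma_additive (canonical_measure lambda).
Proof.
move=> F mF tF mUF; rewrite /canonical_measure; apply: cvg_toP.
  apply: ereal_nondecreasing_is_cvgn => m n mn.
  apply: lee_sum_nneg_natr => // k _ _; apply: integral_ge0 => x _.
  by rewrite lee_fin density_ge0.
rewrite ge0_integral_bigcup//=.
- apply/measurable_EFinP; apply: measurable_funTS.
  apply: measurable_funM => //; apply: measurableT_comp => //.
  exact: measurable_funM.
- by move=> x _; rewrite lee_fin density_ge0.
Qed.

HB.instance Definition _ := isMeasure.Build _ _ _ (canonical_measure lambda)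
  canonical_measure0 canonical_measure_ge0 canonical_measure_sigma_additive.

End canonical_measure_is_measure.

Lemma canonical_measure_setT (lambda : R) :
  bounded_fun g -> canonical_measure lambda setT = 1%E.
Proof.
move=> g_bounded; pose e x := (expR (lambda * g x))%:E.
have me : measurable_fun setT e.
  apply/measurable_EFinP; apply: measurableT_comp => //.
  exact: measurable_funM.
have e0 x : (0 <= e x)%E by rewrite lee_fin expR_ge0.
have [M [_ /(_ (M + 1)) gM]] := g_bounded.
have {}gM x : `|g x| <= M + 1 by apply: gM => //; rewrite ltrDl.
have lgM x : `|lambda * g x| <= `|lambda| * (M + 1).
  by rewrite normrM ler_wpM2l.
have ub : (\int[mu]_x e x <= (expR (`|lambda| * (M + 1)))%:E)%E.
  rewrite -[leRHS]mule1 -(@probability_setT _ _ _ mu) -integral_cst//.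
  apply: ge0_le_integral => //= x _; rewrite lee_fin ler_expR.
  exact: le_trans (ler_norm _) (lgM x).
have lb : ((expR (- (`|lambda| * (M + 1))))%:E <= \int[mu]_x e x)%E.
  rewrite -[leLHS]mule1 -(@probability_setT _ _ _ mu) -integral_cst//.
  apply: ge0_le_integral => //= x _; rewrite lee_fin ler_expR.
  by rewrite lerNl (le_trans _ (lgM x))// -normrN ler_norm.
have Zfin : (\int[mu]_x e x)%E \is a fin_num.
  by rewrite ge0_fin_numE ?integral_ge0// (le_lt_trans ub)// ltry.
have Z0 : 0 < partition_function lambda.
  rewrite -lte_fin /partition_function /Rintegral fineK//.
  by apply: lt_le_trans lb; rewrite lte_fin expR_gt0.
rewrite /canonical_measure.
under eq_integral do rewrite EFinM.
rewrite ge0_integralZr//=; last by rewrite lee_fin invr_ge0 ltW.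
rewrite -[X in (X * _)%E]fineK// -EFinM divff//.
by rewrite gt_eqF.
Qed.

Definition theta (lambda : \bar R) : R :=
  match lambda with
  | r%:E => \int[canonical_measure r]_x g x
  | -oo%E => inf (range g)
  | +oo%E => sup (range g)
  end.

Definition theta_inv : R -> \bar R := 'pinv_(fun=> 0%E) [set: \bar R] theta.

(* Meaningful when theta is a bijection and inf g < y < sup g: then
   theta_inv y is finite. *)
Definition psi (phi : R -> T -> T) (t y : R) : R :=
  \int[canonical_measure (fine (theta_inv y))]_x g (phi t x).

Definition conditioning_set (y delta : R) : set R :=
  let ystar := \int[mu]_x g x in
  if y < ystar then `]y - delta, y]%classic
  else if ystar < y then `[y, y + delta[%classic
  else `]ystar - delta, ystar + delta[%classic.

End canonical_measure.

Definition sample_mean (T : Type) (R : realType) (f : T -> R) n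
    (x : n.-tuple T) : R :=
  (\sum_(i < n) f (tnth x i)) / n%:R.

(* Equal to 0 when C is null. *)
Definition conditional_probability d (T : measurableType d) (R : realType)
    (P : probability T R) (A C : set T) : R :=
  fine (P (A `&` C)) / fine (P C).

(* Main.v *)
(* Let l = theta^-1(y) and weight mu^n by e^(l n G), which is Z(l)^n times the
   product of canonical measures. On {G \in B_delta} one has l (G - y) >= 0, so
   mu^n(G \in B_delta, |F - psi| >= eta) is at most e^(- l n y) times the
   weighted mass of {|F - psi| >= eta}, and Chernoff's bound makes that mass at
   most 2 r^n for some r < Z(l). Conversely, take a tilt l' whose mean y' is
   close to y and such that a window around y' lies inside B_delta: the law of
   large numbers under l' gives mu^n(G \in B_delta) >= b^n / 2, where b tends to
   Z(l) e^(- l y) as y' tends to y and the window shrinks. The conditional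
   probability of a deviation is thus at most 4 (r e^(- l y) / b)^n, which tends
   to 0. *)
Require Import Defs.
From HB Require Import structures.
From mathcomp Require Import all_boot all_order all_algebra.
From mathcomp Require Import all_classical all_reals all_analysis.
From mathcomp Require Import measurable_realfun.
From mathcomp Require Import ring lra.

Set Implicit Arguments.
Unset Strict Implicit.
Unset Printing Implicit Defensive.

Import Order.TTheory GRing.Theory Num.Theory.
Import numFieldNormedType.Exports.

Local Open Scope classical_set_scope.
Local Open Scope ring_scope.

(** From [1 - u <= expR (- u)] one gets [expR u <= 1 / (1 - u)], and [(1 + u + 2 u^2) (1 - u) = 1 +
    u^2 (1 - 2 u)] is at least 1 when [u <= 1/2]. *)
Lemma expR_le_quadratic (R : realType) (u : R) :
  u <= 2^-1 -> expR u <= 1 + u + 2 * u ^+ 2.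
Proof.
move=> u2; have := expR_ge1Dx (- u); rewrite expRN => h.
have e0 := expR_gt0 u.
have : (1 - u) * expR u <= 1.
  by rewrite -ler_pdivlMr// div1r.
have u1 : 0 < 1 - u by lra.
rewrite mulrC -ler_pdivlMr// => /le_trans; apply.
by rewrite ler_pdivrMr//; nra.
Qed.

(** * Chernoff bounds under exponential tilting *)

Section sample_means.
Context d (T : measurableType d) (R : realType).
Implicit Types (f g h : T -> R) (n : nat).

Lemma measurable_tnth_comp n f (i : 'I_n) : measurable_fun setT f ->
  measurable_fun setT (fun x : n.-tuple T => f (tnth x i)).
Proof. by move=> mf; apply: measurableT_comp => //; exact: measurable_tnth. Qed.

Lemma measurable_expR_sum n f : measurable_fun setT f ->
  measurable_fun setT
    (fun x : n.-tuple T => (expR (\sum_(i < n) f (tnth x i)))%:E).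
Proof.
move=> mf; apply/measurable_EFinP; apply: measurableT_comp => //.
by apply: measurable_sum => i; exact: measurable_tnth_comp.
Qed.

Lemma measurable_sample_mean n f : measurable_fun setT f ->
  measurable_fun setT (@sample_mean T R f n).
Proof.
move=> mf; apply: measurable_funM => //; apply: measurable_sum => i.
exact: measurable_tnth_comp.
Qed.

Lemma measurable_sample_mean_preimage n f (A : set R) :
  measurable_fun setT f -> measurable A ->
  measurable (@sample_mean T R f n @^-1` A).
Proof.
move=> mf mA; rewrite -[X in measurable X]setTI.
exact: (measurable_sample_mean mf).
Qed.

Lemma sample_meanE n f (x : n.-tuple T) :
  \sum_(i < n) f (tnth x i) = n%:R * sample_mean f x.
Proof.
rewrite /sample_mean; case: n x => [|n] x; first by rewrite big_ord0 mul0r.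
by rewrite mulrC divfK.
Qed.

Lemma sample_meanN n f (x : n.-tuple T) :
  sample_mean (fun z => - f z) x = - sample_mean f x.
Proof. by rewrite /sample_mean sumrN mulNr. Qed.

(** The case [n = 0] is excluded because the empty tuple has sample mean 0, which may lie outside
    [[a, b]]. *)
Lemma sample_mean_itv n f (x : n.-tuple T) (a b : R) : (0 < n)%N ->
  (forall z, a <= f z <= b) -> a <= sample_mean f x <= b.
Proof.
case: n x => // n x _ fab; have n0 : 0 < n.+1%:R :> R by rewrite ltr0n.
rewrite /sample_mean ler_pdivlMr// ler_pdivrMr//.
rewrite !mulr_natr -[X in _ *+ X <= _](card_ord n.+1).
rewrite -[X in _ && (_ <= _ *+ X)](card_ord n.+1) -!sumr_const.
by apply/andP; split; apply: ler_sum => i _; have /andP[] := fab (tnth x i).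
Qed.

End sample_means.

(** * Integrals of product functions over the power measure *)

Section power_probability_integrals.
Context d (T : measurableType d) (R : realType) (mu : probability T R).

Lemma bounded_integrable (h : T -> R) : measurable_fun setT h ->
  bounded_fun h -> mu.-integrable setT (EFin \o h).
Proof.
move=> mh bh; apply: measurable_bounded_integrable => //.
by rewrite (le_lt_trans (probability_le1 mu measurableT))// ltry.
Qed.

(** Induction on [n]: pulling back along [tuple_cons] splits off the first coordinate, and Tonelli's
    theorem factors the integral. *)
Lemma integral_power_probability_prod n (h : T -> R) :
  measurable_fun setT h -> (forall x, 0 <= h x) ->
  mu.-integrable setT (EFin \o h) ->
  (\int[power_probability mu n]_x (\prod_(i < n) h (tnth x i))%:E =
   ((\int[mu]_x h x) ^+ n)%:E)%E.
Proof.
move=> mh h0 ih.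
have mp k : measurable_fun setT
    (fun x : k.-tuple T => \prod_(i < k) h (tnth x i)).
  by apply: measurable_prod => i _; exact: measurable_tnth_comp.
have p0 k (x : k.-tuple T) : 0 <= \prod_(i < k) h (tnth x i).
  by apply: prodr_ge0 => i _; exact: h0.
elim: n => [|n IHn].
  rewrite integral_dirac// ?diracT ?mul1e ?big_ord0 ?expr0//.
  by apply/measurable_EFinP; exact: mp.
rewrite /= ge0_integral_distribution; last 2 first.
- by apply/measurable_EFinP; exact: (mp n.+1).
- by move=> x; rewrite lee_fin; exact: (p0 n.+1).
rewrite (eq_integral (fun z : T * n.-tuple T =>
    (h z.1 * \prod_(i < n) h (tnth z.2 i))%:E)); last first.
  move=> z _ /=; rewrite big_ord_recl; congr (_ * _)%:E.
  by apply: eq_bigr => i _; rewrite /tuple_cons tnthS.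
rewrite fubini_tonelli1/=; last 2 first.
- apply/measurable_EFinP; apply: measurable_funM.
    exact: measurableT_comp.
  exact: (measurableT_comp (mp n)).
- by move=> z; rewrite lee_fin; apply: mulr_ge0; [exact: h0|exact: p0].
rewrite /fubini_F/=.
transitivity (\int[mu]_x ((h x)%:E * ((\int[mu]_x h x) ^+ n)%:E))%E.
  apply: eq_integral => x _; under eq_integral do rewrite EFinM.
  rewrite ge0_integralZl//; first by rewrite IHn.
  - by apply/measurable_EFinP; exact: mp.
  - by move=> z _; rewrite lee_fin; exact: p0.
  - by rewrite lee_fin; exact: h0.
rewrite ge0_integralZr//.
- rewrite exprS EFinM; congr (_ * _)%E.
  by rewrite /Rintegral fineK//; exact: integrable_fin_num.
- exact/measurable_EFinP.
- by move=> x _; rewrite lee_fin; exact: h0.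
- by rewrite lee_fin exprn_ge0// Rintegral_ge0.
Qed.

Lemma integral_power_probability_expR n (u : T -> R) :
  measurable_fun setT u -> bounded_fun u ->
  (\int[power_probability mu n]_x (expR (\sum_(i < n) u (tnth x i)))%:E =
   ((\int[mu]_x expR (u x)) ^+ n)%:E)%E.
Proof.
move=> mu_ bu; under eq_integral do rewrite expR_sum.
apply: (integral_power_probability_prod n (h := expR \o u)).
- exact: measurableT_comp.
- by move=> x; exact: expR_ge0.
- apply: bounded_integrable; first exact: measurableT_comp.
  have [M [Mr bM]] := bu; exists (expR (M + 1)); split; first exact: num_real.
  move=> N MN x _ /=; rewrite ger0_norm ?expR_ge0// (le_trans _ (ltW MN))//.
  by rewrite ler_expR (le_trans (ler_norm _))// bM// ltrDl.
Qed.

End power_probability_integrals.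

(** Replaces the bound by every number beyond a threshold, which is what [bounded_fun] unfolds to,
    by a single positive bound. *)
Lemma bounded_fun_normP (T : Type) (R : realType) (f : T -> R) :
  bounded_fun f <-> exists2 M, 0 < M & forall x, `|f x| <= M.
Proof.
split=> [[M [Mr fM]]|[M M0 fM]].
  exists (`|M| + 1); first by rewrite ltr_wpDl.
  by move=> x; apply: fM => //; rewrite ltr_pwDr// ler_norm.
exists M; split; first exact: num_real.
by move=> N MN x _; exact: le_trans (fM x) (ltW MN).
Qed.

(** * Exponentially weighted means and the one-sided Chernoff bound *)

Section exponential_tilting.
Context d (T : measurableType d) (R : realType) (mu : probability T R).
Variable g : {mfun T >-> R}.
Hypothesis g_bounded : bounded_fun g.

Notation Z := (partition_function mu g).

Lemma measurable_expR_scale (l : R) :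
  measurable_fun setT (fun x => expR (l * g x)).
Proof. by apply: measurableT_comp => //; exact: measurable_funM. Qed.

Lemma bounded_expR (u : T -> R) : bounded_fun u -> bounded_fun (expR \o u).
Proof.
move=> /bounded_fun_normP[M M0 uM]; apply/bounded_fun_normP; exists (expR M).
  exact: expR_gt0.
move=> x /=; rewrite ger0_norm ?expR_ge0// ler_expR.
exact: le_trans (ler_norm _) (uM x).
Qed.

Lemma bounded_scale (l : R) : bounded_fun (fun x => l * g x).
Proof.
have [M M0 gM] := (bounded_fun_normP g).1 g_bounded; apply/bounded_fun_normP.
exists (`|l| * M + 1); first by rewrite ltr_wpDl ?mulr_ge0// ltW.
by move=> x; rewrite normrM (le_trans (ler_wpM2l _ (gM x)))// lerDl.
Qed.

Lemma bounded_funM (u v : T -> R) :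
  bounded_fun u -> bounded_fun v -> bounded_fun (fun x => u x * v x).
Proof.
move=> /bounded_fun_normP[M M0 uM] /bounded_fun_normP[N N0 vN].
apply/bounded_fun_normP; exists (M * N); first exact: mulr_gt0.
by move=> x; rewrite normrM ler_pM.
Qed.

Lemma bounded_funD (u v : T -> R) :
  bounded_fun u -> bounded_fun v -> bounded_fun (fun x => u x + v x).
Proof.
move=> /bounded_fun_normP[M M0 uM] /bounded_fun_normP[N N0 vN].
apply/bounded_fun_normP; exists (M + N); first exact: addr_gt0.
by move=> x; rewrite (le_trans (ler_normD _ _))// lerD.
Qed.

Lemma bounded_fun_cst (c : R) : bounded_fun (fun _ : T => c).
Proof.
apply/bounded_fun_normP; exists (`|c| + 1); first by rewrite ltr_wpDl.
by move=> _; rewrite lerDl.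
Qed.

Lemma integrable_weight (l : R) :
  mu.-integrable setT (EFin \o (fun x => expR (l * g x))).
Proof.
apply: bounded_integrable; first exact: measurable_expR_scale.
exact: (bounded_expR (bounded_scale l)).
Qed.

Lemma integrable_weighted (l : R) (f : T -> R) :
  measurable_fun setT f -> bounded_fun f ->
  mu.-integrable setT (EFin \o (fun x => f x * expR (l * g x))).
Proof.
move=> mf bf; apply: bounded_integrable.
  by apply: measurable_funM => //; exact: measurable_expR_scale.
by apply: bounded_funM => //; exact: (bounded_expR (bounded_scale l)).
Qed.

(** Serves to integrate the affine functions with which exponentials are compared below. *)
Lemma Rintegral_affine_weight (l a b : R) (f : T -> R) :
  measurable_fun setT f -> bounded_fun f ->
  \int[mu]_x ((a + b * f x) * expR (l * g x)) =
  a * Z l + b * \int[mu]_x (f x * expR (l * g x)).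
Proof.
move=> mf bf; pose w x := expR (l * g x).
rewrite -RintegralZl//; last exact: integrable_weighted.
rewrite /partition_function -RintegralZl//; last exact: integrable_weight.
rewrite -RintegralD//.
- by apply: eq_Rintegral => x _; rewrite mulrDl mulrA.
- by apply: integrable_weighted => //; exact: bounded_fun_cst.
- rewrite [X in EFin \o X](_ : _ = fun x => (b * f x) * expR (l * g x)).
    apply: integrable_weighted; first exact: measurable_funM.
    by apply: bounded_funM => //; exact: bounded_fun_cst.
  by apply/funext => x; rewrite mulrA.
Qed.

Lemma partition_function_gt0 (l : R) : 0 < Z l.
Proof.
have [M M0 lM] := (bounded_fun_normP _).1 (bounded_scale l).
apply: (@lt_le_trans _ _ (expR (- M))); first exact: expR_gt0.
rewrite -[leLHS]mulr1.
have -> : 1 = fine (mu setT) by rewrite probability_setT.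
rewrite -Rintegral_cst//; apply: le_Rintegral => //.
- by apply: bounded_integrable => //; exact: bounded_fun_cst.
- exact: integrable_weight.
- by move=> x _; rewrite ler_expR lerNl (le_trans _ (lM x))// -normrN ler_norm.
Qed.

(** The mean of [f] under the canonical measure of parameter [l], written as a quotient of
    [mu]-integrals; [Rintegral_canonical_measure] makes the identification. *)
Definition tilted_mean (l : R) (f : T -> R) : R :=
  \int[mu]_x (f x * expR (l * g x)) / Z l.

Lemma tilted_meanE l f :
  \int[mu]_x (f x * expR (l * g x)) = tilted_mean l f * Z l.
Proof. by rewrite /tilted_mean divfK// gt_eqF// partition_function_gt0. Qed.

(* Convexity of the log-partition function, in exponential form. *)
Lemma partition_function_tangent (l l' : R) :
  expR ((l' - l) * tilted_mean l g) * Z l <= Z l'.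
Proof.
set y := tilted_mean l g.
rewrite -ler_pdivlMl ?expR_gt0// -expRN {2}/partition_function -RintegralZl//;
  last exact: integrable_weight.
(* The affine function [1 + (l' - l) (g - y)] has tilted mean 1, because [y] is the tilted mean of
   [g]. It lies below [expR ((l' - l) (g - y))] pointwise. *)
have -> : Z l = \int[mu]_x ((1 - (l' - l) * y + (l' - l) * g x) *
    expR (l * g x)).
  rewrite Rintegral_affine_weight// tilted_meanE -/y; ring.
apply: le_Rintegral => //.
- apply: integrable_weighted.
    by apply: measurable_funD => //; exact: measurable_funM.
  by apply: bounded_funD; [exact: bounded_fun_cst|exact: bounded_scale].
- under [X in EFin \o X]eq_fun => x do rewrite -expRD.
  apply: bounded_integrable.
    apply: measurableT_comp => //; apply: measurable_funD => //.
    exact: measurable_funM.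
  apply: (@bounded_expR (fun x => _ + l' * g x)); apply: bounded_funD.
    exact: bounded_fun_cst.
  exact: bounded_scale.
- move=> x _.
  have -> : expR (- ((l' - l) * y)) * expR (l' * g x) =
      expR ((l' - l) * (g x - y)) * expR (l * g x).
    by rewrite -!expRD; congr expR; ring.
  rewrite ler_pM2r ?expR_gt0//; apply: le_trans (expR_ge1Dx _).
  by rewrite mulrBr addrC addrCA addrA addrC addrA.
Qed.

(** Exponential Markov inequality: [r] is the integral of the weight times [expR (s (f - a - eta))].
    For small [s] the gain [s eta] is of first order, while the linear term in [f - a] has mean zero
    and the remainder is quadratic in [s], so [r < Z l]. *)
Lemma tilted_deviation_right (l eta : R) (f : T -> R) :
  measurable_fun setT f -> bounded_fun f -> 0 < eta ->
  exists r, [/\ 0 < r, r < Z l & forall n,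
    (\int[power_probability mu n]_(x in
        [set x | (tilted_mean l f + eta <= sample_mean f x)%R])
      (expR (\sum_(i < n) l * g (tnth x i)))%:E <= (r ^+ n)%:E)%E].
Proof.
move=> mf bf eta0; set a := tilted_mean l f.
have bh : bounded_fun (fun x => f x - a).
  by apply: bounded_funD => //; exact: bounded_fun_cst.
have [K K0 hK] := (bounded_fun_normP _).1 bh.
(* s makes both s * K <= 1/2 and 1 + 2 (s K)^2 < 1 + s eta <= e^(s eta). *)
have D0 : 0 < 4 * K ^+ 2 + 2 * eta * K by nra.
pose s := eta / (4 * K ^+ 2 + 2 * eta * K).
have s0 : 0 < s by rewrite divr_gt0.
have sE : s * (4 * K ^+ 2 + 2 * eta * K) = eta by rewrite divfK// gt_eqF.
clearbody s.
have sK : s * K <= 2^-1 by nra.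
have sK2 : 2 * s * K ^+ 2 < eta by nra.
pose u x := l * g x + s * (f x - a - eta).
have mu_ : measurable_fun setT u.
  apply: measurable_funD; first exact: measurable_funM.
  apply: measurable_funM => //; apply: measurable_funB => //.
  exact: measurable_funB.
have bu : bounded_fun u.
  apply: bounded_funD; first exact: bounded_scale.
  apply: bounded_funM; first exact: bounded_fun_cst.
  by apply: bounded_funD => //; exact: bounded_fun_cst.
have iu : mu.-integrable setT (EFin \o (expR \o u)).
  by apply: bounded_integrable; [exact: measurableT_comp|exact: bounded_expR].
pose r := \int[mu]_x expR (u x).
have r0 : 0 < r.
  have [M M0 uM] := (bounded_fun_normP _).1 bu.
  apply: (@lt_le_trans _ _ (expR (- M))); first exact: expR_gt0.
  rewrite -[leLHS]mulr1.
  have -> : 1 = fine (mu setT) by rewrite probability_setT.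
  rewrite -Rintegral_cst//; apply: le_Rintegral => //.
  - by apply: bounded_integrable => //; exact: bounded_fun_cst.
  - by move=> x _; rewrite ler_expR lerNl (le_trans _ (uM x))// -normrN ler_norm.
exists r; split => //.
(* Integrate the quadratic bound on [expR (s (f - a))]; the linear term vanishes since [a] is the
   tilted mean of [f]. *)
- have le1 : r <= expR (- (s * eta)) * ((1 + 2 * (s * K) ^+ 2) * Z l).
    have -> : (1 + 2 * (s * K) ^+ 2) * Z l =
        \int[mu]_x ((1 + 2 * (s * K) ^+ 2 - s * a + s * f x) *
          expR (l * g x)).
      by rewrite Rintegral_affine_weight// tilted_meanE -/a; ring.
    have mq : measurable_fun setT
        (fun x => 1 + 2 * (s * K) ^+ 2 - s * a + s * f x).
      by apply: measurable_funD => //; exact: measurable_funM.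
    have bq : bounded_fun (fun x => 1 + 2 * (s * K) ^+ 2 - s * a + s * f x).
      apply: bounded_funD; first exact: bounded_fun_cst.
      by apply: bounded_funM => //; exact: bounded_fun_cst.
    rewrite -RintegralZl//; last exact: integrable_weighted.
    apply: le_Rintegral => //.
      rewrite [X in EFin \o X](_ : _ = fun x => (expR (- (s * eta)) *
          (1 + 2 * (s * K) ^+ 2 - s * a + s * f x)) * expR (l * g x)).
        apply: integrable_weighted; first exact: measurable_funM.
        by apply: bounded_funM => //; exact: bounded_fun_cst.
      by apply/funext => x; rewrite mulrA.
    move=> x _.
    have -> : expR (u x) =
        expR (- (s * eta)) * (expR (s * (f x - a)) * expR (l * g x)).
      by rewrite -!expRD; congr expR; rewrite /u; ring.
    rewrite ler_pM2l ?expR_gt0// ler_pM2r ?expR_gt0//.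
    have /ler_normlP[h1 h2] := hK x.
    have v2 : (s * (f x - a)) ^+ 2 <= (s * K) ^+ 2.
      rewrite -[leLHS]real_normK ?num_real//.
      rewrite lerXn2r ?nnegrE ?mulr_ge0 ?(ltW s0) ?(ltW K0)//.
      by rewrite normrM gtr0_norm// ler_wpM2l// ltW.
    apply: le_trans (expR_le_quadratic _) _.
      by apply: le_trans sK; rewrite ler_wpM2l// ltW.
    by move: v2; set V := _ ^+ 2; set W := _ ^+ 2; lra.
  apply: (le_lt_trans le1); rewrite mulrA -ltr_pdivlMr ?partition_function_gt0//.
  rewrite divff ?gt_eqF ?partition_function_gt0//.
  rewrite expRN mulrC ltr_pdivrMr ?expR_gt0// mul1r.
  apply: lt_le_trans (expR_ge1Dx _).
  by rewrite ltrD2l exprMn; nra.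
- move=> n; rewrite -integral_power_probability_expR//.
  have mA : measurable [set x : n.-tuple T | a + eta <= sample_mean f x].
    rewrite (_ : [set _ | _] = @sample_mean T R f n @^-1` `[a + eta, +oo[).
      exact: measurable_sample_mean_preimage.
    by apply/seteqP; split => x /=; rewrite in_itv/= andbT.
  apply: (@le_trans _ _ (\int[power_probability mu n]_(x in
      [set x | (a + eta <= sample_mean f x)%R])
      (expR (\sum_(i < n) u (tnth x i)))%:E)%E).
    apply: ge0_le_integral => //.
    - apply: measurable_funTS.
      apply: (@measurable_expR_sum _ _ _ _ (fun z => l * g z)).
      exact: measurable_funM.
    - by apply: measurable_funTS; exact: measurable_expR_sum.
    (* On the event the extra exponent equals [s n (sample_mean f x - a - eta)], which is
       nonnegative. *)
    - move=> x /= ax; rewrite lee_fin ler_expR /u big_split/= lerDl -mulr_sumr.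
      rewrite sumrB sumrB !sumr_const card_ord sample_meanE.
      rewrite -[a *+ n]mulr_natl -[eta *+ n]mulr_natl -!mulrBr.
      by rewrite mulr_ge0 ?(ltW s0)// mulr_ge0//; lra.
  apply: ge0_subset_integral => //.
  - exact: measurable_expR_sum.
Qed.
End exponential_tilting.

(** * Two-sided deviations and the law of large numbers under a tilt *)

Section tilted_large_deviations.
Context d (T : measurableType d) (R : realType) (mu : probability T R).
Variable g : {mfun T >-> R}.
Hypothesis g_bounded : bounded_fun g.

Notation Z := (partition_function mu g).
Notation tilted_mean := (tilted_mean mu g).


Lemma tilted_meanN (l : R) (f : T -> R) :
  measurable_fun setT f -> bounded_fun f ->
  tilted_mean l (fun x => - f x) = - tilted_mean l f.
Proof.
move=> mf bf; rewrite /tilted_mean -mulNr -mulN1r -RintegralZl//.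
  by congr (_ / _); apply: eq_Rintegral => x _; rewrite mulrA mulN1r.
exact: integrable_weighted.
Qed.

Lemma measurable_deviation n (eta a : R) (f : T -> R) :
  measurable_fun setT f ->
  measurable [set x : n.-tuple T | eta <= `|sample_mean f x - a|].
Proof.
move=> mf; rewrite (_ : [set _ | _] =
  @sample_mean T R f n @^-1` (~` `]a - eta, a + eta[)).
  by apply: measurable_sample_mean_preimage => //; exact: measurableC.
by apply/seteqP; split => x /=; rewrite in_itv/= -ltr_distl leNgt => /negP.
Qed.

(** The one-sided bound is applied to [f] and to [- f]. The factor 2 counts the two tails, and the
    larger of the two rates serves for both. *)
Lemma tilted_deviation (l eta : R) (f : T -> R) :
  measurable_fun setT f -> bounded_fun f -> 0 < eta ->
  exists r, [/\ 0 < r, r < Z l & forall n,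
    (\int[power_probability mu n]_(x in
        [set x | (eta <= `|sample_mean f x - tilted_mean l f|)%R])
      (expR (\sum_(i < n) l * g (tnth x i)))%:E <= (2 * r ^+ n)%:E)%E].
Proof.
move=> mf bf eta0; set a := tilted_mean l f.
have mNf : measurable_fun setT (fun x => - f x) by exact: measurableT_comp.
have bNf : bounded_fun (fun x => - f x).
  have [M M0 fM] := (bounded_fun_normP f).1 bf.
  apply/bounded_fun_normP; exists M => //.
  by move=> x; rewrite normrN.
have [r [r0 rZ hr]] := tilted_deviation_right mu g_bounded l mf bf eta0.
have [s [s0 sZ hs]] := tilted_deviation_right mu g_bounded l mNf bNf eta0.
exists (Num.max r s); split; [by rewrite lt_max r0|by rewrite gt_max rZ|].
move=> n; set A1 := [set x : n.-tuple T | a + eta <= sample_mean f x].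
set A2 := [set x : n.-tuple T |
  tilted_mean l (fun x => - f x) + eta <= sample_mean (fun x => - f x) x].
have mE : measurable_fun setT
    (fun x : n.-tuple T => (expR (\sum_(i < n) l * g (tnth x i)))%:E).
  apply: (@measurable_expR_sum _ _ _ _ (fun z => l * g z)).
  exact: measurable_funM.
have mA (h : T -> R) c : measurable_fun setT h ->
    measurable [set x : n.-tuple T | c <= sample_mean h x].
  move=> mh; rewrite (_ : [set _ | _] = @sample_mean T R h n @^-1` `[c, +oo[).
    exact: measurable_sample_mean_preimage.
  by apply/seteqP; split => x /=; rewrite in_itv/= andbT.
have m1 : measurable A1 by exact: mA.
have m2 : measurable A2 by exact: mA.
have m21 : measurable (A2 `\` A1) by exact: measurableD.
have E0 (x : n.-tuple T) : (0 <= (expR (\sum_(i < n) l * g (tnth x i)))%:E)%E.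
  by rewrite lee_fin expR_ge0.
(* The second tail is cut down to make the union disjoint, so that the integral splits into a
   sum. *)
apply: (@le_trans _ _ (\int[power_probability mu n]_(x in A1 `|` (A2 `\` A1))
    (expR (\sum_(i < n) l * g (tnth x i)))%:E)%E).
  apply: ge0_subset_integral => //.
  - exact: measurable_deviation.
  - exact: measurableU.
  - exact: measurable_funTS.
  - move=> x /= h; rewrite /A1 /A2 /= tilted_meanN// sample_meanN -/a.
    have [h1|h1] := leP (a + eta) (sample_mean f x); [by left|right].
    split; last by move=> h2; lra.
    by move: h; rewrite ler_normr => /orP[]; lra.
rewrite ge0_integral_setU//; last 2 first.
- exact: measurable_funTS.
- by apply/disj_setPS => x [? []].
have [r0' s0'] : 0 <= r /\ 0 <= s by split; exact: ltW.
have rs0 : 0 <= Num.max r s by rewrite le_max r0'.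
rewrite mulr_natl mulr2n EFinD; apply: leeD.
  by apply: le_trans (hr n) _; rewrite lee_fin lerXn2r ?nnegrE// le_max lexx.
apply: (@le_trans _ _ (\int[power_probability mu n]_(x in A2)
    (expR (\sum_(i < n) l * g (tnth x i)))%:E)%E).
  apply: ge0_subset_integral => //; first exact: measurable_funTS.
apply: le_trans (hs n) _.
by rewrite lee_fin lerXn2r ?nnegrE// le_max lexx orbT.
Qed.

Lemma cvg_geometric0 (q : R) : 0 <= q < 1 -> q ^+ n @[n --> \oo] --> (0 : R).
Proof. by move=> /andP[q0 q1]; apply: cvg_expr; rewrite ger0_norm. Qed.

(** The total weighted mass is [Z l ^+ n], and eventually at most half of it lies outside the
    window. Inside, the weight is at most [expR (n (l y + |l| k))]; dividing by this bound returns
    to the untilted measure. *)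
Lemma tilted_window_lower_bound (l k : R) : 0 < k ->
  \forall n \near \oo,
    ((2^-1 * (Z l * expR (- (l * tilted_mean l g + `|l| * k))) ^+ n)%:E <=
     power_probability mu n
       [set x | (`|sample_mean g x - tilted_mean l g| < k)%R])%E.
Proof.
move=> k0; set y := tilted_mean l g.
have [r [r0 rZ hr]] := tilted_deviation l (measurable_funPT g) g_bounded k0.
have Z0 := partition_function_gt0 mu g_bounded l.
have q01 : 0 <= r / Z l < 1.
  by rewrite divr_ge0 ?(ltW r0) ?(ltW Z0)//= ltr_pdivrMr// mul1r.
(* With [(r / Z l) ^+ n < 1/4], the bound [2 r ^+ n] on the deviations is below half of the total
   mass. *)
have /cvgrPdist_lt /(_ (4^-1) ltac:(lra)) := cvg_geometric0 q01.
apply: filterS => n; rewrite sub0r normrN ger0_norm; last first.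
  by rewrite exprn_ge0//; case/andP: q01.
rewrite expr_div_n ltr_pdivrMr ?exprn_gt0// => hn.
set W := [set x | _].
set Bad := [set x : n.-tuple T | k <= `|sample_mean g x - y|].
have mBad : measurable Bad by exact: measurable_deviation.
have WE : W = ~` Bad.
  by apply/seteqP; split => x; rewrite /W /Bad/= ltNge => /negP.
have mW : measurable W by rewrite WE; exact: measurableC.
pose e (x : n.-tuple T) := (expR (\sum_(i < n) l * g (tnth x i)))%:E.
have me : measurable_fun setT e.
  apply: (@measurable_expR_sum _ _ _ _ (fun z => l * g z)).
  exact: measurable_funM.
have e0 x : (0 <= e x)%E by rewrite lee_fin expR_ge0.
have tot : ((Z l ^+ n)%:E = \int[power_probability mu n]_(x in W) e x +
    \int[power_probability mu n]_(x in Bad) e x)%E.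
  rewrite -ge0_integral_setU//; last 2 first.
  - exact: measurable_funTS.
  - by rewrite WE; apply/disj_setPS => x [].
  rewrite WE setUC setUv; apply/esym.
  apply: (@integral_power_probability_expR _ _ _ mu n (fun x => l * g x)).
    exact: measurable_funM.
  exact: bounded_scale.
pose c := expR (n%:R * (l * y + `|l| * k)).
have up : (\int[power_probability mu n]_(x in W) e x <=
    c%:E * power_probability mu n W)%E.
  rewrite -integral_cst//; apply: ge0_le_integral => //.
  - exact: measurable_funTS.
  - move=> x /= xW; rewrite /e lee_fin ler_expR -mulr_sumr sample_meanE.
    rewrite mulrCA ler_wpM2l// -lerBlDl -mulrBr.
    by rewrite (le_trans (ler_norm _))// normrM ler_wpM2l// ltW.
have c0 : 0 < c by exact: expR_gt0.
have : ((Z l ^+ n)%:E <= c%:E * power_probability mu n W + (2 * r ^+ n)%:E)%E.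
  by rewrite tot; apply: leeD => //; exact: hr.
have fW : power_probability mu n W \is a fin_num by exact: fin_num_measure.
rewrite -(fineK fW) -EFinM -EFinD !lee_fin => hZ.
rewrite exprMn -expRM_natl mulrN expRN -/c mulrA ler_pdivrMr//.
have : 2 * r ^+ n <= 2^-1 * Z l ^+ n by lra.
by rewrite [_ * c]mulrC; lra.
Qed.
End tilted_large_deviations.

(** * Conditioning on the sample mean *)

Section tilted_conditioning.
Context d (T : measurableType d) (R : realType) (mu : probability T R).
Variable g : {mfun T >-> R}.
Hypothesis g_bounded : bounded_fun g.

Notation Z := (partition_function mu g).
Notation tilted_mean := (tilted_mean mu g).

Variables (l : R) (B : set R).
Hypothesis mB : measurable B.
(* B lies on the side of the mean where the weight e^(l n G) is at least
   e^(l n y). *)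
Hypothesis B_side : forall z, B z -> 0 <= l * (z - tilted_mean l g).
(* B contains windows around means of other tilts, so close to y that
   rewriting mu^n as a tilted law there costs at most a factor e^(n e). *)
Hypothesis B_window : forall e : R, 0 < e -> exists (l' k : R), [/\ 0 < k,
  forall z, `|z - tilted_mean l' g| < k -> B z &
  `|l'| * (`|tilted_mean l' g - tilted_mean l g| + k) <= e].

Notation C n := (@sample_mean T R g n @^-1` B).

Let measurable_C n : measurable (C n).
Proof. exact: measurable_sample_mean_preimage. Qed.

(** Apply the window bound at the tilt [l']. By the tangent inequality its base is at least
    [Z l * expR (- (l y))] times [expR (- e)], where [e] bounds the cost of the window. *)
Lemma conditioning_lower_bound (c : R) : 0 < c -> c < Z l ->
  exists2 b, c * expR (- (l * tilted_mean l g)) < b &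
    \forall n \near \oo,
      ((2^-1 * b ^+ n)%:E <= power_probability mu n (C n))%E.
Proof.
move=> c0 cZ; have Z0 := partition_function_gt0 mu g_bounded l.
have Zc1 : 1 < Z l / c by rewrite ltr_pdivlMr// mul1r.
(* A cost of [ln (Z l / c)] would only give equality with [c]; half of it leaves a strict
   inequality. *)
have e0 : 0 < ln (Z l / c) / 2 by rewrite divr_gt0// ln_gt0.
have [l' [k [k0 winB small]]] := B_window e0.
have low := tilted_window_lower_bound mu g_bounded l' k0.
have tangent := partition_function_tangent mu g_bounded l l'.
set y := tilted_mean l g in small tangent *.
set y' := tilted_mean l' g in winB small low tangent *.
exists (Z l' * expR (- (l' * y' + `|l'| * k))); last first.
  apply: filterS low => n /le_trans; apply.
  apply: le_measure; rewrite ?inE; [|exact: measurable_C|by move=> x; exact: winB].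
  rewrite (_ : [set _ | _] = @sample_mean T R g n @^-1` `]y' - k, y' + k[).
    exact: measurable_sample_mean_preimage.
  by apply/seteqP; split => x /=; rewrite in_itv/= -ltr_distl.
have cE : c < Z l * expR (- (ln (Z l / c) / 2)).
  rewrite expRN ltr_pdivlMr ?expR_gt0// mulrC -ltr_pdivlMr//.
  rewrite -[ltRHS]lnK ?posrE ?(lt_trans ltr01)// ltr_expR.
  by have := ln_gt0 Zc1; lra.
rewrite -ltr_pdivlMr ?expR_gt0// (lt_le_trans cE)//.
rewrite ler_pdivlMr ?expR_gt0// -mulrA -expRD.
apply: (@le_trans _ _ (expR ((l' - l) * y) * Z l *
    expR (- (l' * y' + `|l'| * k)))); last by rewrite ler_pM2r ?expR_gt0.
rewrite [expR _ * Z l]mulrC -mulrA ler_pM2l// -expRD ler_expR.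
have : l' * (y' - y) <= `|l'| * `|y' - y|.
  by rewrite -normrM ler_norm.
by move: small; rewrite mulrDr; lra.
Qed.

Lemma conditioning_gt0 :
  \forall n \near \oo, (0 < power_probability mu n (C n))%E.
Proof.
have Z0 := partition_function_gt0 mu g_bounded l.
have Z2 : Z l / 2 < Z l by rewrite gtr_pMr// invf_lt1 ?ltr1n.
have [|b bE low] := conditioning_lower_bound _ Z2; first by rewrite divr_gt0.
have b0 : 0 < b by apply: lt_trans bE; rewrite mulr_gt0 ?expR_gt0 ?divr_gt0.
apply: filterS low => n; apply: lt_le_trans.
by rewrite lte_fin mulr_gt0 ?invr_gt0// exprn_gt0.
Qed.

(** The numerator is at most [2 p ^+ n] and the denominator eventually at least [b ^+ n / 2] with
    [p < b], so the quotient is bounded by a vanishing geometric sequence. *)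
Lemma conditional_deviation_cvg0 (f : T -> R) (eta : R) :
  measurable_fun setT f -> bounded_fun f -> 0 < eta ->
  conditional_probability (power_probability mu n)
    [set x | eta <= `|sample_mean f x - tilted_mean l f|] (C n)
    @[n --> \oo] --> (0 : R).
Proof.
move=> mf bf eta0; set y := tilted_mean l g.
have [r [r0 rZ hr]] := tilted_deviation mu g_bounded l mf bf eta0.
(* The Chernoff rate [r < Z l] is used as the constant [c], which is what forces [b] above [p]. *)
have [b bE low] := conditioning_lower_bound r0 rZ.
pose p := r * expR (- (l * y)).
have p0 : 0 < p by rewrite mulr_gt0 ?expR_gt0.
have b0 : 0 < b by exact: lt_trans bE.
have q01 : 0 <= p / b < 1.
  by rewrite divr_ge0 ?(ltW p0) ?(ltW b0)//= ltr_pdivrMr// mul1r.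
apply: (@squeeze_cvgr _ _ _ _ (fun=> 0) (fun n => 4 * (p / b) ^+ n)); last 2 first.
- exact: cvg_cst.
- rewrite -[X in _ --> X](mulr0 4); apply: cvgM; first exact: cvg_cst.
  exact: cvg_geometric0.
apply: filterS low => n low.
rewrite /conditional_probability divr_ge0 ?fine_ge0//=.
set Bad := [set x | _]; set I := Bad `&` _.
have mBad : measurable Bad by exact: measurable_deviation.
have mI : measurable I by apply: measurableI => //; exact: measurable_C.
have up : fine (power_probability mu n I) <= 2 * p ^+ n.
  pose e (x : n.-tuple T) := (expR (\sum_(i < n) l * g (tnth x i)))%:E.
  have me : measurable_fun setT e.
    apply: (@measurable_expR_sum _ _ _ _ (fun z => l * g z)).
    exact: measurable_funM.
  pose c := expR (n%:R * (l * y)).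
  have c0 : 0 < c by exact: expR_gt0.
  have : (c%:E * power_probability mu n I <= (2 * r ^+ n)%:E)%E.
    apply: le_trans (hr n); rewrite -integral_cst//.
    apply: (@le_trans _ _ (\int[power_probability mu n]_(x in I) e x)%E).
      apply: ge0_le_integral => //.
      + by move=> x _; rewrite lee_fin ltW.
      + exact: measurable_funTS.
      (* Here the side condition enters: where the sample mean lies in [B], the weight is at least
         [expR (n l y)]. *)
      + move=> x [_ xC]; rewrite /e lee_fin ler_expR -mulr_sumr sample_meanE.
        rewrite [leRHS]mulrCA ler_wpM2l// -subr_ge0 -mulrBr.
        exact: B_side.
    apply: ge0_subset_integral => //.
    + exact: measurable_funTS.
    + by move=> x _; rewrite lee_fin expR_ge0.
    + by move=> x [].
  have fI : power_probability mu n I \is a fin_num.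
    exact: fin_num_measure.
  move=> h.
  have : c * fine (power_probability mu n I) <= 2 * r ^+ n.
    by rewrite -lee_fin EFinM fineK.
  rewrite /p exprMn -expRM_natl mulrN expRN -/c mulrA ler_pdivlMr//.
  by rewrite mulrC.
have fC : power_probability mu n (C n) \is a fin_num.
  by apply: fin_num_measure; exact: measurable_C.
have lowC : 2^-1 * b ^+ n <= fine (power_probability mu n (C n)).
  by rewrite -lee_fin fineK.
have bn0 : 0 < b ^+ n by exact: exprn_gt0.
have C0 : 0 < fine (power_probability mu n (C n)).
  by apply: lt_le_trans lowC; rewrite mulr_gt0 ?invr_gt0.
rewrite ler_pdivrMr// (le_trans up)// expr_div_n.
rewrite mulrA mulrAC ler_pdivlMr//.
have pn0 : 0 < p ^+ n by exact: exprn_gt0.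
by nra.
Qed.

End tilted_conditioning.

(** * Canonical measures and the inverse of theta *)

Section canonical_measure_integral.
Context d (T : measurableType d) (R : realType) (mu : probability T R).
Variable g : {mfun T >-> R}.
Hypothesis g_bounded : bounded_fun g.

Local Open Scope charge_scope.

(** Change of variables for the Radon-Nikodym derivative, which agrees with the explicit density [w]
    almost everywhere because both have the same integral over every measurable set. *)
Lemma Rintegral_canonical_measure (l : R) (f : T -> R) :
  measurable_fun setT f -> bounded_fun f ->
  \int[canonical_measure mu g l]_x f x = tilted_mean mu g l f.
Proof.
move=> mf bf; pose w x := expR (l * g x) / partition_function mu g l.
have mw : measurable_fun setT w.
  by apply: measurable_funM => //; exact: measurable_expR_scale.
have iw : mu.-integrable setT (EFin \o w).
  apply: bounded_integrable => //; apply: bounded_funM.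
    exact: (bounded_expR (bounded_scale g_bounded l)).
  exact: bounded_fun_cst.
(* Packing the canonical measure as a probability gives access to the Radon-Nikodym theorem and to
   [bounded_integrable]. *)
pose nu : probability T R := HB.pack (canonical_measure mu g l)
  (Measure_isProbability.Build _ _ _ (canonical_measure mu g l)
    (canonical_measure_setT mu l g_bounded)).
have numu : nu `<< mu.
  apply/null_content_dominatesP => A mA muA0.
  apply: null_set_integral => //; exact: measurable_funTS (measurable_int _ iw).
transitivity (\int[nu]_x f x) => //.
rewrite /Rintegral -(Radon_Nikodym_change_of_variables numu)//; last first.
  exact: bounded_integrable.
transitivity (fine (\int[mu]_x (f x * w x)%:E)).
  congr fine; apply: ae_eq_integral => //.
  - apply: emeasurable_funM; first exact/measurable_EFinP.
    by apply: measurable_int; exact: Radon_Nikodym_integrable.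
  - by apply/measurable_EFinP; exact: measurable_funM.
  - under [X in ae_eq _ _ _ X]eq_fun do rewrite EFinM.
    apply: ae_eqe_mul2l.
    apply: integral_ae_eq => //.
    + exact: Radon_Nikodym_integrable.
    + exact/measurable_EFinP.
    + by move=> A _ mA; rewrite -Radon_Nikodym_integral.
rewrite /tilted_mean -RintegralZr//; last exact: integrable_weighted.
by congr fine; apply: eq_integral => x _; rewrite /w mulrA.
Qed.

End canonical_measure_integral.

(** * Monotonicity of tilted means and position of the conditioning set *)

Section theta_inverse.
Context d (T : measurableType d) (R : realType) (mu : probability T R).
Variable g : {mfun T >-> R}.
Hypothesis g_bounded : bounded_fun g.

Notation tilted_mean := (tilted_mean mu g).

Lemma theta_EFin (l : R) : theta mu g l%:E = tilted_mean l g.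
Proof. exact: Rintegral_canonical_measure. Qed.

(** Combining the tangent inequalities at [l] and at [l'] gives [expR ((l' - l) (u - v)) <= 1] for
    the means [u] at [l] and [v] at [l']. *)
Lemma tilted_mean_nondecreasing (l l' : R) :
  l' <= l -> tilted_mean l' g <= tilted_mean l g.
Proof.
rewrite le_eqVlt => /predU1P[->//|ll'].
have Z0 := partition_function_gt0 mu g_bounded l.
have h1 := partition_function_tangent mu g_bounded l l'.
have h2 := partition_function_tangent mu g_bounded l' l.
have := le_trans (ler_wpM2l (expR_ge0 _) h1) h2.
move: (tilted_mean l g) (tilted_mean l' g) => u v.
rewrite mulrA -expRD -ler_pdivlMr// divff ?gt_eqF// expR_le1.
move=> uv; rewrite -subr_ge0 -(pmulr_rge0 _ (_ : 0 < l - l')) ?subr_gt0//.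
by move: uv; rewrite -oppr_ge0; congr (0 <= _); ring.
Qed.

(** Places the limit value [psi] in [Y], as the relative closure and interior require. *)
Lemma tilted_mean_itv (l a b : R) (f : T -> R) : measurable_fun setT f ->
  (forall x, a <= f x <= b) -> a <= tilted_mean l f <= b.
Proof.
move=> mf fab; have Z0 := partition_function_gt0 mu g_bounded l.
have bf : bounded_fun f.
  apply/bounded_fun_normP; exists (`|a| + `|b| + 1).
    by rewrite ltr_wpDl// addr_ge0.
  move=> x; have /andP[ax xb] := fab x.
  have := ler_norm b; have := ler_norm (- a); rewrite normrN => ? ?.
  by have := normr_ge0 a; have := normr_ge0 b; rewrite ler_norml; lra.
have iw := integrable_weight mu g_bounded l.
have iwf := integrable_weighted mu g_bounded l mf bf.
rewrite ler_pdivlMr// ler_pdivrMr// -!RintegralZl//.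
by apply/andP; split; apply: le_Rintegral => //;
  try (by apply: integrable_weighted => //; exact: bounded_fun_cst);
  move=> x _; rewrite ler_pM2r ?expR_gt0//; have /andP[] := fab x.
Qed.

(** Turns the comparison of [y] with the [mu]-mean of [g] into a comparison of two tilts. *)
Lemma tilted_mean0 : tilted_mean 0 g = \int[mu]_x g x.
Proof.
have E x : expR (0 * g x) = 1 by rewrite mul0r expR0.
rewrite /tilted_mean/partition_function.
under eq_Rintegral do rewrite E mulr1.
under [X in _ / X]eq_Rintegral do rewrite E.
have m1 : fine (mu setT) = 1 by rewrite probability_setT.
by rewrite Rintegral_cst// m1 mulr1 divr1.
Qed.

Hypothesis theta_bij : set_bij [set: \bar R]
  `[inf (range g), sup (range g)]%classic (theta mu g).

(** The infinite parameters are sent to the endpoints, so an interior value has a finite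
    preimage. *)
Lemma theta_inv_EFin (v : R) : inf (range g) < v -> v < sup (range g) ->
  exists2 l, theta_inv mu g v = l%:E & tilted_mean l g = v.
Proof.
move=> iv vs; have [_ _ surj] := theta_bij.
have : theta mu g (theta_inv mu g v) = v.
  by apply: (surjpK _ surj); rewrite inE/= in_itv/= !ltW.
case: (theta_inv mu g v) => [l||]/= h.
- by exists l => //; rewrite -theta_EFin.
- by move: vs; rewrite -h ltxx.
- by move: iv; rewrite -h ltxx.
Qed.

Variables (y l : R).
Hypotheses (y_inf : inf (range g) < y) (y_sup : y < sup (range g)).
Hypothesis tilted_mean_l : tilted_mean l g = y.

(* Surjectivity of theta provides tilts whose means lie on either side of y,
   and monotonicity bounds every tilt in between; this replaces continuity. *)
Lemma tilts_near (s delta e : R) : `|s| = 1 -> 0 < delta -> 0 < e ->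
  exists l' k, [/\ 0 < k, 2 * k <= delta, tilted_mean l' g = y + s * k &
    `|l'| * (`|tilted_mean l' g - y| + k) <= e].
Proof.
move=> s1 delta0 e0.
have mean v : inf (range g) < v -> v < sup (range g) ->
    exists l', tilted_mean l' g = v.
  by move=> iv vs; have [l' _ l'v] := theta_inv_EFin iv vs; exists l'.
move: (inf (range g)) (sup (range g)) y_inf y_sup mean => a b ay yb mean.
(* These two tilts, with means halfway to the endpoints, will enclose [l'] and so bound its absolute
   value by [L]. *)
have [lm lmE] : exists l', tilted_mean l' g = (a + y) / 2 by apply: mean; lra.
have [lp lpE] : exists l', tilted_mean l' g = (b + y) / 2 by apply: mean; lra.
pose L := `|lm| + `|lp| + 1.
have L0 : 0 < L by rewrite ltr_wpDl// addr_ge0.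
(* The third keeps [2 k] below [delta] and below [e / L], and [y + s k] strictly between the two
   halfway means. *)
pose k := Num.min (Num.min delta (e / L))
  (Num.min (y - a) (b - y)) / 3.
have k0 : 0 < k.
  by rewrite divr_gt0// !lt_min delta0 divr_gt0//= !subr_gt0 ay yb.
have k3 : [/\ 3 * k <= delta, 3 * k <= e / L, 3 * k <= y - a & 3 * k <= b - y].
  by rewrite /k mulrC divfK//; split; rewrite !ge_min lexx ?orbT.
have [kd ke ki ks] := k3.
have sE : s = 1 \/ s = -1.
  by move: s1; case: (ger0P s) => _ h; [left|right]; lra.
have [l' l'E] : exists l', tilted_mean l' g = y + s * k.
  by apply: mean; clear -sE k0 ki ks ay yb; case: sE => ->; lra.
exists l', k; split => //; first lra.
rewrite l'E addrAC subrr add0r normrM s1 mul1r gtr0_norm//.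
have lml' : lm <= l'.
  rewrite leNgt; apply/negP => /ltW/tilted_mean_nondecreasing.
  by rewrite lmE l'E; clear -sE k0 ki ks ay yb; case: sE => ->; lra.
have l'lp : l' <= lp.
  rewrite leNgt; apply/negP => /ltW/tilted_mean_nondecreasing.
  by rewrite lpE l'E; clear -sE k0 ki ks ay yb; case: sE => ->; lra.
have l'L : `|l'| <= L.
  have := ler_norm lp; have := ler_norm (- lm); rewrite normrN => ? ?.
  by have := normr_ge0 lm; have := normr_ge0 lp; rewrite ler_norml /L; lra.
move: ke; rewrite ler_pdivlMr// => ke.
have k2 : 0 <= k + k by rewrite addr_ge0// ltW.
apply: (le_trans (ler_wpM2r k2 l'L)).
by clear -ke k0 L0; nra.
Qed.

(** By monotonicity [l <= 0] when [y] is below the [mu]-mean of [g], and [0 <= l] when it is above.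
    In the two-sided case injectivity of [theta] forces [l = 0]. *)
Lemma conditioning_set_side (delta z : R) :
  conditioning_set mu g y delta z -> 0 <= l * (z - y).
Proof.
rewrite /conditioning_set -tilted_mean0 -tilted_mean_l.
have mono l1 l2 := @tilted_mean_nondecreasing l1 l2.
case: ltgtP => [ll0|l0l|E] /=; rewrite in_itv/=.
- have : l <= 0 by rewrite leNgt; apply/negP => /ltW/mono; rewrite leNgt ll0.
  by move=> l0 /andP[_ zy]; nra.
- have : 0 <= l by rewrite leNgt; apply/negP => /ltW/mono; rewrite leNgt l0l.
  by move=> l0 /andP[yz _]; nra.
have [_ inj _] := theta_bij.
suff -> : l = 0 by rewrite mul0r.
have : l%:E = 0%:E; last by case.
by apply: inj; [exact: in_setT|exact: in_setT|rewrite !theta_EFin].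
Qed.

(** Off the [mu]-mean, [y] is an endpoint of the interval and no window around it fits, so the mean
    is shifted inwards by [k]. *)
Lemma conditioning_set_window (delta e : R) : 0 < delta -> 0 < e ->
  exists l' k, [/\ 0 < k,
    forall z, `|z - tilted_mean l' g| < k -> conditioning_set mu g y delta z &
    `|l'| * (`|tilted_mean l' g - y| + k) <= e].
Proof.
move=> delta0 e0; rewrite /conditioning_set -tilted_mean0.
case: ltgtP => [ys|sy|E].
- have s1 : `|-1| = 1 :> R by rewrite normrN1.
  have [l' [k [k0 kd l'E small]]] := tilts_near s1 delta0 e0.
  exists l', k; split => // z; rewrite l'E ltr_distl /= in_itv/=.
  by move=> /andP[h1 h2]; apply/andP; split; lra.
- have [l' [k [k0 kd l'E small]]] := tilts_near (normr1 _) delta0 e0.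
  exists l', k; split => // z; rewrite l'E ltr_distl /= in_itv/=.
  by move=> /andP[h1 h2]; apply/andP; split; lra.
(* The zero tilt has no cost, and its window is the whole conditioning set. *)
- exists 0, delta; split => //; last by rewrite normr0 mul0r ltW.
  by move=> z; rewrite ltr_distl /= in_itv.
Qed.

End theta_inverse.

Lemma measurable_conditioning_set d (T : measurableType d) (R : realType)
    (mu : probability T R) (g : {mfun T >-> R}) (y delta : R) :
  measurable (conditioning_set mu g y delta).
Proof. by rewrite /conditioning_set; case: ltgtP. Qed.

(** * Elementary properties of conditional probabilities *)

Section conditional_probability_lemmas.
Context d (T : measurableType d) (R : realType) (P : probability T R).
Implicit Types A C : set T.

Lemma conditional_probability_ge0 A C : 0 <= conditional_probability P A C.
Proof. by rewrite /conditional_probability divr_ge0 ?fine_ge0. Qed.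

Lemma le_conditional_probability A A' C :
  measurable A -> measurable A' -> measurable C -> A `<=` A' ->
  conditional_probability P A C <= conditional_probability P A' C.
Proof.
move=> mA mA' mC AA'; rewrite /conditional_probability.
have mAC : measurable (A `&` C) by exact: measurableI.
have mA'C : measurable (A' `&` C) by exact: measurableI.
rewrite ler_wpM2r ?invr_ge0 ?fine_ge0// fine_le ?fin_num_measure//.
by apply: le_measure; rewrite ?inE//; exact: setSI.
Qed.

Lemma conditional_probabilityU A A' C :
  measurable A -> measurable A' -> measurable C ->
  conditional_probability P (A `|` A') C <=
  conditional_probability P A C + conditional_probability P A' C.
Proof.
move=> mA mA' mC; rewrite /conditional_probability -mulrDl.
have mAC : measurable (A `&` C) by exact: measurableI.
have mA'C : measurable (A' `&` C) by exact: measurableI.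
rewrite ler_wpM2r ?invr_ge0 ?fine_ge0// -fineD ?fin_num_measure// setIUl.
rewrite fine_le ?fin_numD ?fin_num_measure//; first exact: measurableU.
exact: measureU2.
Qed.

(** Positivity of [P C] matters: for null [C] both conditional probabilities are 0 by the convention
    on division. *)
Lemma conditional_probabilityC A C :
  measurable A -> measurable C -> (0 < P C)%E ->
  conditional_probability P (~` A) C = 1 - conditional_probability P A C.
Proof.
move=> mA mC PC; rewrite /conditional_probability.
have mAC : measurable (A `&` C) by exact: measurableI.
have mcAC : measurable (~` A `&` C).
  by apply: measurableI => //; exact: measurableC.
have fC : 0 < fine (P C) by rewrite fine_gt0// PC ltey_eq fin_num_measure.
have CE : fine (P C) = fine (P (A `&` C)) + fine (P (~` A `&` C)).
  rewrite -fineD ?fin_num_measure// -measureU//.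
    by rewrite -setIUl setUv setTI.
  by rewrite setIACA setICr set0I.
by rewrite -[1](@divff _ (fine (P C))) ?gt_eqF// -mulrBl {2}CE addrAC subrr add0r.
Qed.

End conditional_probability_lemmas.

(** Union bound, by induction on the list. The space depends on [n] because the power measures live
    on tuples of varying length. *)
Lemma conditional_probability_bigcup_cvg0 (R : realType) (I : eqType)
    d (T : nat -> measurableType d) (P : forall n, probability (T n) R)
    (D : I -> forall n, set (T n)) (C : forall n, set (T n)) (s : seq I) :
  (forall n, measurable (C n)) -> (forall i n, measurable (D i n)) ->
  (forall i, conditional_probability (P n) (D i n) (C n)
    @[n --> \oo] --> (0 : R)) ->
  conditional_probability (P n) (\big[setU/set0]_(i <- s) D i n) (C n)
    @[n --> \oo] --> (0 : R).
Proof.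
move=> mC mD D0; elim: s => [|i s IHs].
  under eq_cvg => n.
    rewrite big_nil /conditional_probability set0I measure0 mul0r; over.
  exact: cvg_cst.
apply: (@squeeze_cvgr _ _ _ _ (fun=> 0) (fun n =>
  conditional_probability (P n) (D i n) (C n) +
  conditional_probability (P n) (\big[setU/set0]_(i <- s) D i n) (C n))).
- near=> n; rewrite big_cons conditional_probability_ge0/=.
  apply: conditional_probabilityU; [exact: mD| |exact: mC].
  by apply: bigsetU_measurable => j _; exact: mD.
- exact: cvg_cst.
- by rewrite -[X in _ --> X](addr0 0); exact: cvgD.
Unshelve. all: by end_near. Qed.

(** * Closure and interior relative to [Y] in terms of distances *)

Section subspace_neighborhoods.
Context (R : realType) (Y B : set R) (a : R).
Hypotheses (Ya : Y a) (BY : B `<=` Y).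

Let nbhsE : nbhs (a : subspace Y) = within Y (nbhs (a : R)).
Proof. by case: (nbhs_subspaceP Y (a : subspace Y)). Qed.

Lemma not_closure_subspace : ~ closure (B : set (subspace Y)) a ->
  exists2 eta : R, 0 < eta & forall z, B z -> eta <= `|z - a|.
Proof.
move=> ncl; apply: contrapT => noeta; apply: ncl => U.
rewrite nbhsE => /nbhs_ballP[eta /= eta0 aU].
apply: contrapT => BU0; apply: noeta; exists eta => // z Bz.
rewrite leNgt; apply/negP => za; apply: BU0; exists z; split => //.
by apply: aU; [rewrite /ball/= distrC|exact: BY].
Qed.

Lemma interior_subspace : interior (B : set (subspace Y)) a ->
  exists2 eta : R, 0 < eta & forall z, Y z -> `|z - a| < eta -> B z.
Proof.
rewrite /interior/= nbhsE => /nbhs_ballP[eta /= eta0 aB].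
by exists eta => // z Yz za; apply: aB => //; rewrite /ball/= distrC.
Qed.

End subspace_neighborhoods.

(** * The limits 0 and 1 of the conditional probability *)

Theorem mainTheorem2 (R : realType) (X : completeMetricType R)
  (Xsep : separable X)
  (mu : probability (borel X) R)
  (g : {mfun borel X >-> R})
  (g_bounded : bounded_fun (g : X -> R))
  (g_cont : \forall x \ae mu, {for x, continuous (g : X -> R)})
  (T : set R) (T0 : T 0)
  (phi : R -> X -> X)
  (phi_meas : forall t, T t ->
    measurable_fun [set: borel X] (phi t : borel X -> borel X))
  (phi_cont : forall t, T t -> \forall x \ae mu, {for x, continuous (phi t)})
  (phi0 : phi 0 = id)
  (gphi_cont : forall t, T t ->
    \forall x \ae mu, {for x, continuous ((g : X -> R) \o phi t)})
  (Y := `[inf (range g), sup (range g)]%classic : set R)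
  (theta_bij : set_bij [set: \bar R] Y (theta mu g))
  (y : R) (y_inf : inf (range g) < y) (y_sup : y < sup (range g))
  (delta : R) (delta_gt0 : 0 < delta)
  (m : nat) (t : 'I_m -> R) (tT : forall i, T (t i))
  (B : 'I_m -> set R)
  (BY : forall i, B i `<=` Y) (B_meas : forall i, measurable (B i))
  (C := fun n : nat =>
    [set x : n.-tuple (borel X) |
       conditioning_set mu g y delta (sample_mean g x)])
  (A := fun n : nat =>
    [set x : n.-tuple (borel X) |
       forall i, B i (sample_mean (g \o phi (t i)) x)]) :
  [/\ \forall n \near \oo, (0 < power_probability mu n (C n))%E,
      (exists j, ~ closure (B j : set (subspace Y)) (psi mu g phi (t j) y)) ->
        conditional_probability (power_probability mu n) (A n) (C n)
          @[n --> \oo] --> (0 : R) &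
      (forall i, interior (B i : set (subspace Y)) (psi mu g phi (t i) y)) ->
        conditional_probability (power_probability mu n) (A n) (C n)
          @[n --> \oo] --> (1 : R)].
Proof.
have gb : bounded_fun g by exact: g_bounded.
pose f i : borel X -> R := fun x => g (phi (t i) x).
have fY i x : Y (f i x).
  have [M M0 gM] := (bounded_fun_normP _).1 g_bounded.
  rewrite /Y/= in_itv/=; apply/andP; split.
    apply: ge_inf; last exact: imageT.
    exists (- M) => _ [z _ <-].
    by have := gM z; rewrite ler_norml => /andP[].
  apply: ub_le_sup; last exact: imageT.
  exists M => _ [z _ <-].
  by have := gM z; rewrite ler_norml => /andP[].
have mf i : measurable_fun [set: borel X] (f i).
  exact: (measurableT_comp (measurable_funPT g) (phi_meas _ (tT i))).
have bf i : bounded_fun (f i).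
  have [M M0 gM] := (bounded_fun_normP _).1 g_bounded.
  by apply/bounded_fun_normP; exists M => // x; exact: gM.
have [l inv_l mean_l] := theta_inv_EFin gb theta_bij y_inf y_sup.
have psiE i : psi mu g phi (t i) y = tilted_mean mu g l (f i).
  rewrite /psi inv_l.
  exact: (Rintegral_canonical_measure mu gb l (mf i) (bf i)).
have psiY i : Y (psi mu g phi (t i) y).
  rewrite psiE /Y/= in_itv/=; apply: (tilted_mean_itv mu gb l (mf i)) => x.
  by have := fY i x; rewrite /Y/= in_itv.
have mB := measurable_conditioning_set mu g y delta.
have side z : conditioning_set mu g y delta z ->
    0 <= l * (z - tilted_mean mu g l g).
  by rewrite mean_l; exact: (conditioning_set_side gb theta_bij mean_l).
have window e : 0 < e -> exists l' k : R, [/\ 0 < k,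
    forall z, `|z - tilted_mean mu g l' g| < k ->
      conditioning_set mu g y delta z &
    `|l'| * (`|tilted_mean mu g l' g - tilted_mean mu g l g| + k) <= e].
  rewrite mean_l.
  exact: (conditioning_set_window gb theta_bij y_inf y_sup delta_gt0).
have mC n : measurable (C n).
  exact: (measurable_sample_mean_preimage (measurable_funPT g) mB).
have mA n : measurable (A n).
  rewrite (_ : A n = \bigcap_(i in [set: 'I_m])
      (@sample_mean (borel X) R (f i) n @^-1` B i)).
    apply: fin_bigcap_measurable => [|i _]; first exact: finite_finset.
    exact: (measurable_sample_mean_preimage (mf i) (B_meas i)).
  by apply/seteqP; split => x Ax i; [move=> _|]; exact: Ax.
have C_gt0 := conditioning_gt0 gb mB window.
split => //.
(* Outside the closure, [B j] keeps a distance [eta] from [psi], so [A n] is contained in a single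
   deviation event. *)
- move=> [j]; rewrite /Y => /(not_closure_subspace (psiY j) (BY j)).
  move=> [eta eta0 far].
  have cvg0 := conditional_deviation_cvg0 gb mB side window
    (mf j) (bf j) eta0.
  apply: (@squeeze_cvgr _ _ _ _ (fun=> 0) _ _ _ _ _ cvg0); last exact: cvg_cst.
  near=> n; rewrite conditional_probability_ge0/=.
  apply: le_conditional_probability; [exact: mA| |exact: mC|].
    exact: measurable_deviation (mf j).
  by move=> x /(_ j) /far; rewrite psiE.
- move=> Bpsi.
  have near_psi i : exists2 eta : R, 0 < eta &
      forall z, Y z -> `|z - psi mu g phi (t i) y| < eta -> B i z.
    exact: interior_subspace.
  have /choice[eta etaP] : forall i, exists eta : R, 0 < eta /\
      forall z, Y z -> `|z - psi mu g phi (t i) y| < eta -> B i z.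
    by move=> i; have [eta ? ?] := near_psi i; exists eta.
  (* Outside the union of these finitely many deviation events every sample mean falls into its
     [B i]. *)
  pose D i n := [set x : n.-tuple (borel X) |
    eta i <= `|sample_mean (f i) x - tilted_mean mu g l (f i)|].
  have mD i n : measurable (D i n) by exact: measurable_deviation (mf i).
  have cvg0 i : conditional_probability (power_probability mu n) (D i n) (C n)
      @[n --> \oo] --> (0 : R).
    by apply: (conditional_deviation_cvg0 gb mB side window) => //;
      have [] := etaP i.
  have := conditional_probability_bigcup_cvg0 (index_enum 'I_m) mC mD cvg0.
  move=> cvgU; have : 1 - conditional_probability (power_probability mu n)
      (\big[setU/set0]_i D i n) (C n) @[n --> \oo] --> (1 : R).
    rewrite -[X in _ --> X]subr0; apply: cvgB; last exact: cvgU.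
    exact: cvg_cst.
  move=> cvg1; apply: (squeeze_cvgr _ cvg1 (cvg_cst (1 : R))).
  near=> n.
  (* Only for positive [n] are the sample means sure to lie in [Y], where the relative interior
     gives information. *)
  have n0 : (0 < n)%N by near: n; exact: nbhs_infty_gt.
  have Cn0 : (0 < power_probability mu n (C n))%E by near: n.
  have mU : measurable (\big[setU/set0]_i D i n).
    by apply: bigsetU_measurable => i _; exact: mD.
  apply/andP; split; last first.
    rewrite -subr_ge0 -conditional_probabilityC; [|exact: mA|exact: mC|exact: Cn0].
    exact: conditional_probability_ge0.
  rewrite lerBlDr -lerBlDl -conditional_probabilityC; [|exact: mA|exact: mC|exact: Cn0].
  apply: le_conditional_probability; [|exact: mU|exact: mC|].
    exact: measurableC (mA n).
  move=> x; apply: contra_notP => xD i.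
  have [_ near_i] := etaP i; apply: near_i.
    rewrite /Y/= in_itv/=; apply: (@sample_mean_itv _ (borel X) R n (f i)) => // z.
    by have := fY i z; rewrite /Y/= in_itv.
  rewrite ltNge; apply/negP => far; apply: xD.
  by rewrite -bigcup_seq; exists i; rewrite /= ?mem_index_enum// /D/= -psiE.
Unshelve. all: by end_near. Qed.
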